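(* Let $c\ge 0$ be an integer and ${\bowtie}\in\{\le,=,\ge\}$. Given a CNF $\psi$, a set $X\subseteq\mathrm{lits}(\psi)$ of literals, and a tree decomposition of $\psi$ of width $k$, one can encode the cardinality constraint $\mathrm{card}_{\bowtie c}(X)$ as a CNF such that $$\mathrm{tw}\big(\psi\wedge\mathrm{card}_{\bowtie c}(X)\big)\le k+3c+3.$$
   Context: $\mathrm{lits}(\psi)$ is the set of literals of $\psi$. The cardinality constraint $\mathrm{card}_{\bowtie c}(X)$ expresses that the number of literals in $X$ assigned to true is $\bowtie c$ (at most, exactly, or at least $c$). An encoding of it is a CNF over the variables of $\psi$ and possibly fresh auxiliary variables such that an assignment of $\mathrm{vars}(\psi)$ can be extended to a satisfying assignment of this CNF if and only if the number of literals of $X$ it makes true is $\bowtie c$. The treewidth $\mathrm{tw}$ of a CNF is the treewidth of its primal graph, whose vertices are the variables and whose edges join variables occurring together in a clause; a tree decomposition of $\psi$ is one of its primal graph. Width is maximum bag size minus one. *)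

(* Defs.v *)
From HB Require Import structures.
From mathcomp Require Import all_boot all_order all_algebra finmap.
From mathcomp Require Import boolp.

Set Implicit Arguments.
Unset Strict Implicit.
Unset Printing Implicit Defensive.

Import Order.TTheory GRing.Theory Num.Theory.
Local Open Scope fset_scope.

(* Propositional variables are natural numbers, so that fresh variables are
   always available.  The literal x is (x, true), its negation (x, false). *)
Definition lit := (nat * bool)%type.
Definition clause := {fset lit}.
Definition cnf := {fset clause}.

Definition clause_vars (C : clause) : {fset nat} := [fset l.1 | l in C].

Definition vars (psi : cnf) : {fset nat} := \bigcup_(C <- psi) clause_vars C.

(* Both literals of every variable of psi, whether or not each polarity
   actually occurs in a clause. *)
Definition lits (psi : cnf) : {fset lit} := vars psi `*` [fset true; false].

Definition lit_true (tau : nat -> bool) (l : lit) : bool := tau l.1 == l.2.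

Definition satisfies (tau : nat -> bool) (psi : cnf) : Prop :=
  forall C, C \in psi -> exists2 l, l \in C & lit_true tau l.

Definition cnf_and (psi phi : cnf) : cnf := psi `|` phi.

Inductive cmp := AtMost | Exactly | AtLeast.

Definition cmp_holds (op : cmp) (m c : nat) : bool :=
  match op with
  | AtMost => m <= c
  | Exactly => m == c
  | AtLeast => c <= m
  end.

Definition num_true (tau : nat -> bool) (X : {fset lit}) : nat :=
  #|` [fset l in X | lit_true tau l]|.

(* The variables of phi outside vars psi are the auxiliary ones.  Only the
   values of beta on vars psi matter (when X `<=` lits psi), so quantifying over
   total valuations beta amounts to quantifying over assignments of vars psi. *)
Definition encodes_card (psi : cnf) (op : cmp) (c : nat) (X : {fset lit})
    (phi : cnf) : Prop :=
  forall beta : nat -> bool,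
    (exists2 tau : nat -> bool, {in vars psi, tau =1 beta} & satisfies tau phi)
    <-> cmp_holds op (num_true beta X) c.

Definition primal_graph (psi : cnf) : rel (vars psi) :=
  fun x y => (val x != val y) &&
    [exists C : psi, (val x \in clause_vars (val C)) &&
                     (val y \in clause_vars (val C))].

Definition is_tree (I : finType) (t : rel I) : Prop :=
  [/\ 0 < #|I|, symmetric t, irreflexive t,
      forall i j, connect t i j
    & forall s : seq I, ucycle t s -> size s < 3].

Record tree_decomposition (V : finType) (e : rel V) := TreeDecomposition {
  td_node : finType;
  td_edge : rel td_node;
  td_bag : td_node -> {set V};
  td_tree : is_tree td_edge;
  td_vertex : forall v, exists i, v \in td_bag i;
  td_cover : forall u v, e u v ->
    exists i, (u \in td_bag i) && (v \in td_bag i);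
  td_connected : forall v i j, v \in td_bag i -> v \in td_bag j ->
    connect [rel a b | [&& td_edge a b, v \in td_bag a & v \in td_bag b]] i j
}.

Definition max_bag (V : finType) (e : rel V) (D : tree_decomposition e) : nat :=
  \max_(i : td_node D) #|td_bag i|.

(* Integer-valued: a decomposition all of whose bags are empty has width -1. *)
Definition width (V : finType) (e : rel V) (D : tree_decomposition e) : int :=
  ((max_bag D)%:Z - 1)%R.

Lemma ex_max_bag (V : finType) (e : rel V) :
  exists n, `[< exists D : tree_decomposition e, max_bag D = n >].
Proof.
have tree1 : is_tree (fun _ _ : unit => false).
  split=> //; first by rewrite card_unit.
    by move=> [] [].
  by case=> [//|[] [|[] [|[] s]]].
have D : tree_decomposition e.
  apply: (@TreeDecomposition V e unit _ (fun=> [set: V]) tree1).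
  - by move=> v; exists tt; rewrite in_setT.
  - by move=> u v _; exists tt; rewrite !in_setT.
  - by move=> v [] [] _ _; apply: connect0.
by exists (max_bag D); apply/asboolP; exists D.
Qed.

Definition treewidth (V : finType) (e : rel V) : int :=
  ((ex_minn (ex_max_bag e))%:Z - 1)%R.

Definition tw (psi : cnf) : int := treewidth (@primal_graph psi).

(* Main.v *)
(* A tree decomposition is linearised into a list of bags, each of which is a
   leaf hanging from one bag further down the list.  Adding the bags one leaf
   at a time, every bag carries an open counter: a group of c+1 auxiliary
   variables whose number of true members is the count, capped at c+1, still
   to be supplied by it and by the leaves added to it later.  Hanging a leaf B
   from a bag A with counter o introduces two bags: A with o, a new counter o1
   of A and a counter F, constrained by o = o1 + F, and B with F and a counter
   oB, constrained by F = oB + (literals of X over variables new in B).  No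
   bag grows by more than three counters, and any Boolean constraint over a
   single bag is a CNF over that bag.  In the end the open counters are set
   to zero. *)
Require Import Defs.
From mathcomp Require Import all_boot all_order all_algebra finmap.
From mathcomp Require Import boolp zify.

Set Implicit Arguments.
Unset Strict Implicit.
Unset Printing Implicit Defensive.

Import Order.TTheory GRing.Theory Num.Theory.
Local Open Scope fset_scope.

(** * Tree decompositions as lists with the running intersection property *)

(* Running intersection property: a new bag B meets the union of the earlier
   ones inside a single earlier bag A. *)
Inductive rip : seq {fset nat} -> Prop :=
| rip_seq1 B : rip [:: B]
| rip_cons A B bs : rip bs -> A \in bs ->
    (forall v E, E \in bs -> v \in E -> v \in B -> v \in A) -> rip (B :: bs).

Lemma connect_crossing (T : finType) (e : rel T) (S : {pred T}) x y :
  connect e x y -> x \in S -> y \notin S ->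
  exists a b, [/\ a \in S, b \notin S & e a b].
Proof.
case/connectP=> p; elim: p x => [|z p IHp] x /=.
  by move=> _ -> xS /negP.
case/andP=> exz ez yE xS yS; case: (boolP (z \in S)) => zS.
  exact: IHp zS yS.
by exists x, z.
Qed.

Section TreeToRip.
Variables (I : finType) (t : rel I) (bag : I -> {fset nat}).
Hypothesis tree_t : is_tree t.
Hypothesis bag_connected : forall v i j, v \in bag i -> v \in bag j ->
  connect [rel a b | [&& t a b, v \in bag a & v \in bag b]] i j.

(** The path from [i] to [k] through nodes whose bags contain [v] has to enter [s], by an edge from
    some [a], reachable from [i] outside [s], to some [b]. If [b] were not [j], the path from [i] to
    [a] outside [s] and the path from [b] to [j] inside [s] would close up to a cycle of length at
    least three. So [b] is [j], whose bag therefore contains [v]. *)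
Lemma rip_extend (s : seq I) (i j : I) :
  {in s &, forall a b, connect [rel a b | [&& t a b, a \in s & b \in s]] a b} ->
  j \in s -> i \notin s -> t j i ->
  forall v k, k \in s -> v \in bag k -> v \in bag i -> v \in bag j.
Proof.
have [_ symt _ _ acyc] := tree_t.
move=> conn js is_ tji v k ks vk vi.
pose e := [rel a b | [&& t a b, a \notin s & b \notin s]].
have kC : k \notin connect e i.
  apply/negP=> /connect_crossing cr.
  have [||a [b [/negP aS bS]]] := cr [predC (mem s)]; rewrite ?inE ?ks ?is_ //.
  by case/and3P=> _ _ bs; move: bS; rewrite inE bs.
(* Here the path leaves the component of [i] in the complement of [s]. *)
have [|a [b [aC bC /and3P[tab va vb]]]] :=
  connect_crossing (S := connect e i) (bag_connected vi vk) _ kC.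
  exact: connect0.
have as_ : a \notin s.
  apply/negP=> as_; have [||x [y [xS yS]]] :=
    connect_crossing (S := [predC (mem s)]) (aC : connect e i a); rewrite ?inE ?as_ ?is_ //.
  by case/and3P=> _ _ ys; move: yS; rewrite inE ys.
have bs : b \in s.
  apply: contraR bC => bs; apply: (connect_trans (aC : connect e i a)).
  by apply: connect1; rewrite /= tab as_.
have [<- //|bj] := eqVneq b j.
case/connectP: (aC : connect e i a) => p0 /shortenP[p pe pU _] aE {p0}.
case/connectP: (conn _ _ bs js) => q0 /shortenP[q qe qU _] jE {q0}.
have ps : {in i :: p, forall x, x \notin s}.
  move=> x; rewrite inE => /predU1P[-> //|].
  elim: p i {aE pU is_ tji vi kC aC bC as_} pe => //= y p IHp z /andP[/and3P[_ _ ys] yp].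
  by rewrite inE => /predU1P[-> //|]; apply: IHp yp.
have qs : {in b :: q, forall x, x \in s}.
  move=> x; rewrite inE => /predU1P[-> //|].
  elim: q b {bj jE qU bs tab vb bC} qe => //= y q IHq z /andP[/and3P[_ _ ys] yq].
  by rewrite inE => /predU1P[-> //|]; apply: IHq yq.
(* The shortened paths have no repetitions, [ps] and [qs] make them disjoint, and [q] is nonempty
   because [b] differs from [j]. *)
have /acyc : ucycle t ((i :: p) ++ (b :: q)).
  apply/andP; split.
    rewrite /= rcons_path cat_path last_cat /= -aE -jE tab tji.
    rewrite !andbT; apply/andP; split.
      by apply: sub_path pe => x y /and3P[].
    by apply: sub_path qe => x y /and3P[].
  rewrite cat_uniq pU qU andbT; apply/hasPn=> x /qs xs.
  by apply/negP=> /ps; rewrite xs.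
rewrite size_cat; case: q jE {qe qU qs} => [/= jb|y q _]; last by rewrite /= !addnS.
by rewrite jb eqxx in bj.
Qed.

(** As long as the connected set [s] misses a node, some edge leaves it; the endpoint outside is
    prepended, and [rip_extend] shows that its bag meets the earlier ones inside the bag of the
    other endpoint. *)
Lemma tree_rip : exists2 s : seq I, forall i, i \in s & rip (map bag s).
Proof.
have [I_gt0 symt _ conn acyc] := tree_t.
have grow n : n < #|I| -> exists s : seq I, [/\ uniq s, size s = n.+1,
    rip (map bag s) & {in s &, forall a b,
      connect [rel a b | [&& t a b, a \in s & b \in s]] a b}].
  elim: n => [|n IHn] nI.
    have [i _] : exists i : I, i \in I by apply/card_gt0P.
    exists [:: i]; split=> //; first exact: rip_seq1.
    by move=> a b; rewrite !inE => /eqP-> /eqP->; apply: connect0.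
  have [s [s_uniq s_size s_rip s_conn]] := IHn (ltnW nI).
  have [x xs] : exists x, x \notin s.
    apply/existsP; rewrite -[X in is_true X]negbK negb_exists; apply/negP=> /forallP sI.
    have : #|I| <= size s.
      rewrite -(card_uniqP s_uniq); apply: subset_leq_card.
      by apply/subsetP=> y _; have := sI y; rewrite negbK.
    by rewrite s_size leqNgt nI.
  have [y ys] : exists y, y \in s.
    case: s s_size {s_uniq s_rip s_conn xs} => // y s _.
    by exists y; rewrite mem_head.
  have [j [i [js is_ tji]]] := connect_crossing (S := mem s) (conn y x) ys xs.
  exists (i :: s); split=> /=; rewrite ?is_ ?s_size //.
    apply: (@rip_cons (bag j)) => //; first exact: map_f.
    move=> v _ /mapP[k ks ->] vk vi.
    exact: (rip_extend s_conn js is_ tji ks vk vi).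
  have sub a b : a \in s -> b \in s ->
      connect [rel a b | [&& t a b, a \in i :: s & b \in i :: s]] a b.
    move=> as_ bs; apply: connect_sub (s_conn a b as_ bs) => u v /and3P[tuv us vs].
    by apply: connect1; rewrite /= tuv !inE us vs !orbT.
  have ij : connect [rel a b | [&& t a b, a \in i :: s & b \in i :: s]] i j.
    by apply: connect1; rewrite /= symt tji !inE eqxx js orbT.
  have ji : connect [rel a b | [&& t a b, a \in i :: s & b \in i :: s]] j i.
    by apply: connect1; rewrite /= tji !inE eqxx js orbT.
  move=> a b; rewrite !inE => /predU1P[->|as_] /predU1P[->|bs].
  - exact: connect0.
  - exact: connect_trans ij (sub _ _ js bs).
  - exact: connect_trans (sub _ _ as_ js) ji.
  - exact: sub.
have [|s [s_uniq s_size s_rip _]] := grow #|I|.-1; first by rewrite prednK.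
exists s => // i.
have := subset_cardP (A := mem s) (B := predT); rewrite (card_uniqP s_uniq) s_size.
rewrite prednK // => /(_ erefl (subset_predT _)) sT; by rewrite (sT i).
Qed.
End TreeToRip.

(** On a cycle through [None] both the successor and the predecessor are [Some j], so without
    repetition its length is at most two. A cycle avoiding [None] is already a cycle of [t]. *)
Lemma ucycle_pendant (I : finType) (t : rel I) (t' : rel (option I)) (j : I) :
  (forall x, t' None x = (x == Some j)) -> symmetric t' ->
  (forall x y, t' (Some x) (Some y) = t x y) ->
  (forall s, ucycle t s -> size s < 3) -> forall s, ucycle t' s -> size s < 3.
Proof.
move=> t'N symt' t'S acyc s /andP[cs us].
case: (boolP (None \in s)) => [/rot_to[n s' sE]|sN].
  rewrite -(size_rot n) sE; move: cs us; rewrite -(rot_cycle n) -(rot_uniq n) sE.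
  case: s' {sE} => // x s' /=; rewrite t'N => /andP[/eqP-> ].
  rewrite rcons_path symt' t'N => /andP[_ /eqP lE] /and3P[_ js _].
  case: s' js lE => // y s' js lE.
  by rewrite -lE /= mem_last in js.
have sE : s = map Some (pmap id s).
  elim: s sN {cs us} => //= -[x|] s IHs; rewrite inE //= => sN.
  by rewrite /= -IHs.
rewrite sE size_map; apply: acyc; move: cs us; rewrite sE.
rewrite map_inj_uniq; last by move=> ? ? [].
rewrite /ucycle -sE => cs ->; rewrite andbT.
move: cs; rewrite {1}sE; case: (pmap id s) => //= x p.
rewrite -map_rcons path_map => h; apply: sub_path h => a b /=.
by rewrite t'S.
Qed.

(** The converse of [tree_rip]: each new entry [B] becomes a leaf [None], attached to a node [j]
    whose bag is the [A] of the running intersection property. *)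
Lemma rip_tree bs : rip bs -> exists (I : finType) (t : rel I) (bag : I -> {fset nat}),
  [/\ is_tree t, forall B, B \in bs <-> exists i, bag i = B
    & forall v i j, v \in bag i -> v \in bag j ->
      connect [rel a b | [&& t a b, v \in bag a & v \in bag b]] i j].
Proof.
elim=> [B|A B {}bs _ [I [t [bag [[I_gt0 symt irrt conn acyc] bagE bagC]]]] /bagE[j jA] BA].
  exists unit, (fun _ _ => false), (fun=> B); split.
  - split=> //; first by rewrite card_unit.
      by move=> [] [].
    by case=> [//|[] [|[] [|[] s]]].
  - move=> B'; rewrite inE; split=> [/eqP->|[_ ->]] //; by exists tt.
  - by move=> v [] [] _ _; apply: connect0.
pose t' : rel (option I) := fun x y => match x, y with
  | Some x, Some y => t x y | Some x, None => x == j | None, Some y => y == j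
  | None, None => false end.
pose bag' x := if x is Some i then bag i else B.
have symt' : symmetric t' by move=> [x|] [y|] //=.
have embed (e : rel I) (e' : rel (option I)) a b :
    (forall x y, e x y -> e' (Some x) (Some y)) ->
    connect e a b -> connect e' (Some a) (Some b).
  move=> ee' /connectP[p pe ->]; apply/connectP; exists (map Some p).
    by rewrite path_map; apply: sub_path pe => x y; apply: ee'.
  by rewrite last_map.
exists (option I), t', bag'; split.
- split=> //.
  + by rewrite card_option.
  + by case.
  + have csym : connect_sym t' by apply: sym_connect_sym.
    have cN x : connect t' (Some x) None.
      apply: (@connect_trans _ _ (Some j)); first exact: (embed t).
      by apply: connect1; rewrite /= eqxx.
    move=> [x|] [y|]; [exact: (embed t)|exact: cN|rewrite csym; exact: cN|exact: connect0].
  + by apply: (@ucycle_pendant _ t t' j) => //; case.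
- move=> C; rewrite inE; split.
    case/predU1P=> [->|/bagE[i <-]]; [by exists None|by exists (Some i)].
  case=> -[i|] /= <-; last by rewrite eqxx.
  by apply/orP; right; apply/bagE; exists i.
- move=> v; pose ev := [rel a b | [&& t' a b, v \in bag' a & v \in bag' b]].
  have csym : connect_sym ev.
    by apply: sym_connect_sym => x y /=; rewrite symt' [X in _ && X]andbC.
  have cS a b : v \in bag a -> v \in bag b -> connect ev (Some a) (Some b).
    by move=> va vb; apply: (embed _ _ _ _ _ (bagC v a b va vb)).
  have cN a : v \in bag a -> v \in B -> connect ev (Some a) None.
    move=> va vB.
    (* The running intersection property forces [v] into the bag of [j], the only neighbour of the
       new leaf. *)
    have vj : v \in bag j by rewrite jA; apply: (BA v (bag a)) => //; apply/bagE; exists a.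
    apply: connect_trans (cS a j va vj) _.
    by apply: connect1; rewrite /= eqxx vj.
  move=> [a|] [b|] /= va vb; [exact: cS|exact: cN|rewrite csym; exact: cN|exact: connect0].
Qed.

(** * Projections of CNFs and capped counters *)

Definition depends_on (T : Type) (V : {pred nat}) (f : (nat -> bool) -> T) :=
  forall s t, {in V, s =1 t} -> f s = f t.

Lemma clause_varsP (C : clause) v :
  reflect (exists2 l, l \in C & v = l.1) (v \in clause_vars C).
Proof. by apply: (iffP (imfsetP _ _ _ _)) => -[l lC ->]; exists l. Qed.

(** One clause is taken for each falsifying assignment [W] of [V]: [cl W] fails exactly at the
    valuations that agree with [W] on [V]. There may be exponentially many clauses, but all of them
    stay over [V]. *)
Lemma cnf_of_pred (V : {fset nat}) (Q : (nat -> bool) -> bool) :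
  depends_on [in V] Q ->
  exists2 phi : cnf, forall C, C \in phi -> clause_vars C `<=` V
    & forall t, satisfies t phi <-> Q t.
Proof.
move=> QV; pose cl (W : {fset nat}) : clause := [fset (v, v \notin W) | v in V].
exists [fset cl W | W in fpowerset V & ~~ Q (fun v => v \in W)] => [C|t].
  case/imfsetP=> W _ ->; apply/fsubsetP=> v /clause_varsP[l /imfsetP[u /= uV ->] ->].
  exact: uV.
split=> [sat|Qt C /imfsetP[W /= /[!inE] /andP[_ QW] ->]].
  apply/negPn/negP=> nQ; pose W := [fset v in V | t v].
  have tW : {in V, t =1 (fun v => v \in W)} by move=> v vV; rewrite !inE vV.
  have [|l] := sat (cl W).
    apply/imfsetP; exists W => //=; rewrite inE -(QV _ _ tW) nQ andbT fpowersetE.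
    by apply/fsubsetP=> v; rewrite !inE => /andP[].
  by case/imfsetP=> v /= vV ->; rewrite /lit_true /= -tW //; case: (t v).
case: (boolP (all (fun v => t v == (v \in W)) V)) => [/allP tW|].
  by rewrite -(QV t) ?Qt // in QW => v /tW/eqP.
case/allPn=> v vV tv; exists (v, v \notin W); first by apply/imfsetP; exists v.
by move: tv; rewrite /lit_true /=; case: (t v); case: (v \in W).
Qed.

(** A summand exceeding [c] decides the comparison by itself, whatever its exact value. This is why
    counters of [c.+1] variables suffice. *)
Lemma cmp_holds_minn op a b c :
  cmp_holds op (minn c.+1 a + b)%N c = cmp_holds op (a + b)%N c.
Proof. case: op => /=; lia. Qed.

Lemma satisfiesU t (phi phi' : cnf) :
  satisfies t (phi `|` phi') <-> satisfies t phi /\ satisfies t phi'.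
Proof.
split=> [h|[h h'] C]; last by rewrite inE => /orP[/h|/h'].
by split=> C Cp; apply: h; rewrite inE Cp ?orbT.
Qed.

Lemma depends_on_count (V : {pred nat}) (s : seq nat) :
  {subset s <= V} -> depends_on V (fun t => count t s).
Proof. by move=> sV t t' tt'; apply: eq_in_count => v /sV/tt'. Qed.

Lemma depends_on_num_true (V : {pred nat}) (X : {fset lit}) :
  {in X, forall l, l.1 \in V} -> depends_on V (fun t => num_true t X).
Proof.
move=> XV t t' tt'; congr #|` _|; apply/fsetP=> l; rewrite !inE.
by case: (boolP (l \in X)) => //= /XV lV; rewrite /lit_true tt'.
Qed.

Lemma num_trueU t (X Y : {fset lit}) :
  [disjoint X & Y] -> num_true t (X `|` Y) = (num_true t X + num_true t Y)%N.
Proof.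
move=> XY; rewrite -cardfsUI.
have -> : [fset l in X | lit_true t l] `&` [fset l in Y | lit_true t l] = fset0.
  apply/fsetP=> l; rewrite !inE; apply/negP=> /andP[/andP[lX _] /andP[lY _]].
  by have := fdisjointP XY l lX; rewrite lY.
rewrite cardfs0 addn0; congr #|` _|; apply/fsetP=> l; rewrite !inE.
by rewrite andb_orl.
Qed.

Lemma exists_count (o : seq nat) (m : nat) (t : nat -> bool) :
  uniq o -> m <= size o ->
  exists2 s : nat -> bool, {in [predC o], s =1 t} & count s o = m.
Proof.
move=> uo mo; exists (fun v => if v \in o then v \in take m o else t v).
  by move=> v; rewrite inE => /negPf->.
rewrite -[X in count _ X](cat_take_drop m) count_cat.
move: uo; rewrite -{1}(cat_take_drop m o) cat_uniq => /and3P[_ /hasPn td _].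
rewrite (@eq_in_count _ _ predT) => [|v vt]; last by rewrite vt (mem_take vt).
rewrite count_predT size_takel // (@eq_in_count _ _ pred0) ?count_pred0 ?addn0 // => v vd.
by rewrite (mem_drop vd) (negPf (td v vd)).
Qed.

(* Q is equivalent to phi with the variables of In existentially quantified. *)
Definition projects (In : {fset nat}) (phi : cnf) (Q : (nat -> bool) -> bool) :=
  forall t, (exists2 s, {in [predC In], s =1 t} & satisfies s phi) <-> Q t.

(** Elimination of a counter: once [psi] ties [o] to the capped value of [f], quantifying [o] away
    replaces its count by [f]. The cap is harmless by [cmp_holds_minn], and it makes every required
    value attainable with [c.+1] variables. *)
Lemma projects_count op c (In : {fset nat}) (phi psi : cnf) (o : seq nat)
    (f g : (nat -> bool) -> nat) :
  uniq o -> size o = c.+1 -> {in o, forall v, v \notin In} ->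
  depends_on [predC In `|` [fset v in o]] f ->
  depends_on [predC In `|` [fset v in o]] g ->
  (forall t, satisfies t psi <-> count t o == minn c.+1 (f t)) ->
  projects In phi (fun t => cmp_holds op (count t o + g t)%N c) ->
  projects (In `|` [fset v in o]) (phi `|` psi)
    (fun t => cmp_holds op (f t + g t)%N c).
Proof.
move=> uo so oIn df dg psiE phiE t; split.
  case=> s st /satisfiesU[sphi /psiE/eqP sE].
  have : cmp_holds op (count s o + g s)%N c by apply/phiE; exists s.
  by rewrite sE cmp_holds_minn (df _ _ st) (dg _ _ st).
move=> h.
have [t' t't t'o] : exists2 s : nat -> bool,
    {in [predC o], s =1 t} & count s o = minn c.+1 (f t).
  by apply: exists_count => //; rewrite so geq_minl.
have t't2 : {in [predC In `|` [fset v in o]], t' =1 t}.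
  by move=> v; rewrite !inE negb_or => /andP[_ vo]; apply: t't; rewrite inE.
(* The projection is applied at [t'] rather than [t]: the solution [s] differs from [t'] at most on
   [In], so it keeps the values just chosen on [o]. *)
have /phiE[s st' sphi] : cmp_holds op (count t' o + g t')%N c.
  by rewrite t'o cmp_holds_minn (dg _ _ t't2).
have st : {in [predC In `|` [fset v in o]], s =1 t}.
  move=> v vV; rewrite st' ?t't2 //; move: vV; rewrite !inE negb_or.
  by case/andP.
exists s => //; apply/satisfiesU; split=> //; apply/psiE.
rewrite (df _ _ st) -t'o; apply/eqP/eq_in_count=> v /oIn vIn.
by rewrite st' // inE.
Qed.

Lemma eq_projects (In : {fset nat}) (phi : cnf) (Q Q' : (nat -> bool) -> bool) :
  Q =1 Q' -> projects In phi Q -> projects In phi Q'.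
Proof. by move=> QQ' h t; rewrite -QQ'. Qed.

Lemma depends_onD (V : {pred nat}) (f g : (nat -> bool) -> nat) :
  depends_on V f -> depends_on V g -> depends_on V (fun t => f t + g t)%N.
Proof. by move=> fV gV s t st; rewrite (fV _ _ st) (gV _ _ st). Qed.

Lemma fset_bound (F : {fset nat}) : exists n, {in F, forall v, v < n}%N.
Proof.
exists (\max_(v <- F) v).+1 => v vF.
by rewrite ltnS (big_rem v vF) leq_maxl.
Qed.

Lemma card_fsetU_seq (A : {fset nat}) (o : seq nat) :
  (#|` A `|` [fset v in o]| <= #|` A| + size o)%N.
Proof.
apply: leq_trans (leq_card_fsetU _ _).1 _.
by rewrite leq_add2l card_fseq size_undup.
Qed.

(* The list is kept abstract because [inE] would unfold [iota]. *)
Lemma interval_list n m :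
  exists o : seq nat, [/\ uniq o, size o = m & forall v, v \in o = (n <= v < n + m)%N].
Proof.
by exists (iota n m); split; [exact: iota_uniq|exact: size_iota|exact: mem_iota].
Qed.

Ltac clear_lia := clear; lia.

(** * Adding bags leaf by leaf *)

Definition slot := ({fset nat} * seq nat)%type.
Definition open_vars (st : seq slot) : seq nat := flatten [seq s.2 | s <- st].

Definition lits_in (X : {fset lit}) (bs : seq {fset nat}) : {fset lit} :=
  [fset l in X | has (fun B : {fset nat} => l.1 \in B) bs].

(* In holds the auxiliary variables that phi quantifies away; a slot (A, o) is
   a bag A with its open counter o. *)
Record partial_encoding (op : cmp) (c : nat) (X : {fset lit}) (N M : nat)
    (bs bs' : seq {fset nat}) (phi : cnf) (In : {fset nat}) (st : seq slot) :
    Prop := PartialEncoding {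
  pe_rip : rip bs';
  pe_card : forall E, E \in bs' -> (#|` E| <= M + 3 * c.+1)%N;
  pe_cover : forall C, C \in phi -> exists2 E, E \in bs' & clause_vars C `<=` E;
  pe_slot : forall A, A \in bs -> exists o, (A, o) \in st;
  pe_size : forall A o, (A, o) \in st -> size o = c.+1;
  pe_bag : forall A o, (A, o) \in st ->
    exists2 E, E \in bs' & A `|` [fset v in o] `<=` E;
  pe_uniq : uniq (open_vars st);
  pe_disj : {in open_vars st, forall v, v \notin In};
  pe_fresh_open : {in open_vars st, forall v, N <= v}%N;
  pe_fresh_in : {in In, forall v, N <= v}%N;
  pe_old : forall v E, E \in bs' -> v \in E -> (v < N)%N ->
    has (fun B : {fset nat} => v \in B) bs;
  pe_proj : projects In phi (fun t =>
    cmp_holds op (count t (open_vars st) + num_true t (lits_in X bs))%N c)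
}.

Section Encoding.
Variables (op : cmp) (c : nat) (X : {fset lit}) (N M : nat).
Notation PE := (partial_encoding op c X N M).

(** The whole constraint is written over the single bag, with [o] standing for what later leaves
    will contribute. Nothing is quantified away yet, so [In] is empty. *)
Lemma partial_encoding_seq1 (B : {fset nat}) :
  {in B, forall v, v < N}%N -> (#|` B| <= M)%N ->
  exists bs' phi In st, PE [:: B] bs' phi In st.
Proof.
move=> BN BM; have [o [uo so oE]] := interval_list N c.+1.
pose E := B `|` [fset v in o].
have oN v : v \in o -> (N <= v)%N by rewrite oE => /andP[].
have [|phi phiV phiE] := @cnf_of_pred E (fun t =>
    cmp_holds op (count t o + num_true t (lits_in X [:: B]))%N c).
  move=> s t st; congr (cmp_holds _ (_ + _)%N _).
    by apply: (@depends_on_count [in E] _ _ s t st) => v vo; rewrite !inE vo orbT.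
  apply: (@depends_on_num_true [in E] _ _ s t st) => l.
  by rewrite !inE /= orbF => /andP[_ ->].
have oE' : open_vars [:: (B, o)] = o by rewrite /open_vars /= cats0.
exists [:: E], phi, fset0, [:: (B, o)]; split; rewrite ?oE' //.
- exact: rip_seq1.
- move=> _ /[!inE]/eqP->; apply: leq_trans (card_fsetU_seq _ _) _.
  by rewrite so; lia.
- by move=> C /phiV; exists E; rewrite ?inE.
- by move=> A /[!inE]/eqP->; exists o; rewrite inE.
- by move=> A o' /[!inE]/eqP[_ ->].
- by move=> A o' /[!inE]/eqP[-> ->]; exists E; rewrite ?inE.
- by move=> v _ /[!inE]/eqP-> /[!inE]/orP[vB _|/oN]; rewrite /= ?vB //; lia.
- move=> t; rewrite -phiE; split=> [[s st sphi]|tphi]; last by exists t.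
  by rewrite (_ : t = s) //; apply/funext => v; rewrite st // inE.
Qed.

(** Two uses of [projects_count] give the new projection: first [o] is eliminated in favour of [o1]
    and [F], then [F] in favour of [oB] and the new literals. The bag [E1], with three counters,
    accounts for the bound [3 * c.+1]. *)
Lemma partial_encoding_cons (A B : {fset nat}) bs bs' phi In st :
  PE bs bs' phi In st -> A \in bs ->
  (forall v E, E \in bs -> v \in E -> v \in B -> v \in A) ->
  (forall E, E \in B :: bs -> {in E, forall v, v < N} /\ #|` E| <= M)%N ->
  exists bs' phi In st, PE (B :: bs) bs' phi In st.
Proof.
move=> [rip' card' cov slot' size' bag' uniq' disj' fro fri old proj] Abs AB bsN.
have [o ost] := slot' A Abs; have [E0 E0bs oE0] := bag' A o ost.
have so := size' A o ost.
have [[BN BM] [AN AM]] : ({in B, forall v, v < N} /\ #|` B| <= M)%N /\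
    ({in A, forall v, v < N} /\ #|` A| <= M)%N.
  by split; apply: bsN; rewrite inE ?eqxx ?Abs ?orbT.
(* All variables used so far and [N] itself lie below [n], so the numbers from [n] on are fresh and
   differ from the original variables. *)
have [n nP] := fset_bound (In `|`
  [fset v in flatten [seq (E : seq nat) | E : {fset nat} <- bs']] `|` [fset N]).
have Nn : (N < n)%N by apply: nP; rewrite !inE eqxx orbT.
have Inn v : v \in In -> (v < n)%N by move=> vIn; apply: nP; rewrite !inE vIn.
have bsn E v : E \in bs' -> v \in E -> (v < n)%N.
  move=> Ebs vE; apply: nP; rewrite !inE.
  by apply/orP; left; apply/orP; right; apply/flatten_mapP; exists E.
(* Only one slot is spent: a bag repeated in the list may own several counters, and the others stay
   open. *)
pose st1 := rem (A, o) st.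
have stE : perm_eq st ((A, o) :: st1) by exact: perm_to_rem.
have openE : perm_eq (open_vars st) (o ++ open_vars st1).
  by have := perm_flatten (perm_map snd stE).
have openst v : v \in open_vars st = (v \in o) || (v \in open_vars st1).
  by rewrite (perm_mem openE) mem_cat.
have [uo uo1 u1] : [/\ uniq o, {in open_vars st1, forall v, v \notin o} & uniq (open_vars st1)].
  by move: uniq'; rewrite (perm_uniq openE) cat_uniq => /and3P[-> /hasPn h ->]; split.
have st1st s : s \in st1 -> s \in st by exact: mem_rem.
have openn v : v \in open_vars st -> (v < n)%N.
  case/flatten_mapP=> -[A' o'] /bag'[E Ebs sub] vo'; apply: (bsn E) => //.
  by apply: (fsubsetP sub); rewrite !inE vo' orbT.
have on v : v \in o -> (v < n)%N by move=> vo; apply: openn; rewrite openst vo.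
have oN v : v \in o -> (N <= v)%N by move=> vo; apply: fro; rewrite openst vo.
have [o1 [uo1' so1 o1n]] := interval_list n c.+1.
have [F [uF sF Fn]] := interval_list (n + c.+1) c.+1.
have [oB [uoB soB oBn]] := interval_list (n + c.+1 + c.+1) c.+1.
(* Literals over variables of earlier bags are already counted there; removing them makes each
   literal count once. *)
pose Y := lits_in X (B :: bs) `\` lits_in X bs.
have YB l : l \in Y -> l.1 \in B.
  rewrite !inE /= => /andP[] /negP nl /andP[lX /orP[//|lbs]].
  by case: nl; rewrite lX lbs.
have XN l : l \in lits_in X bs -> (l.1 < N)%N.
  rewrite !inE => /andP[_ /hasP[E Ebs lE]].
  by have [|EN _] := bsN E; [rewrite inE Ebs orbT|apply: EN].
have XE : lits_in X (B :: bs) = lits_in X bs `|` Y.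
  apply/fsetP=> l; rewrite !inE /=.
  by case: (l \in X); case: (l.1 \in B); case: (has _ _).
have XY : [disjoint lits_in X bs & Y].
  by apply/fdisjointP=> l lX; rewrite in_fsetD lX.
pose E1 := A `|` [fset v in o] `|` [fset v in o1] `|` [fset v in F].
pose E2 := B `|` [fset v in F] `|` [fset v in oB].
have [|psi1 psi1V psi1E] := @cnf_of_pred E1 (fun t =>
    count t o == minn c.+1 (count t o1 + count t F)%N).
  move=> s t st'; congr (_ == minn _ (_ + _)%N).
  - by apply: (@depends_on_count [in E1] _ _ s t st') => v vo; rewrite !inE vo !orbT.
  - by apply: (@depends_on_count [in E1] _ _ s t st') => v vo; rewrite !inE vo !orbT.
  - by apply: (@depends_on_count [in E1] _ _ s t st') => v vo; rewrite !inE vo !orbT.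
have [|psi2 psi2V psi2E] := @cnf_of_pred E2 (fun t =>
    count t F == minn c.+1 (count t oB + num_true t Y)%N).
  move=> s t st'; congr (_ == minn _ (_ + _)%N).
  - by apply: (@depends_on_count [in E2] _ _ s t st') => v vo; rewrite !inE vo !orbT.
  - by apply: (@depends_on_count [in E2] _ _ s t st') => v vo; rewrite !inE vo !orbT.
  - by apply: (@depends_on_num_true [in E2] _ _ s t st') => l /YB lB; rewrite !inE lB.
exists [:: E2, E1 & bs'], (phi `|` psi1 `|` psi2),
  (In `|` [fset v in o] `|` [fset v in F]), [:: (A, o1), (B, oB) & st1].
have openE' : open_vars [:: (A, o1), (B, oB) & st1] = o1 ++ oB ++ open_vars st1 by [].
split.
(* [E1] hangs from [E0], which contains [A] and [o], because [o1] and [F] are fresh. [E2] hangs from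
   [E1]: a variable of [B] in an older bag is below [N], so [pe_old] finds it in a bag of [bs], and
   [AB] then puts it into [A]. *)
- apply: (@rip_cons E1); rewrite ?mem_head //.
    apply: (@rip_cons E0) => // v E Ebs vE; rewrite !inE -!orbA.
    case/or4P=> [vA|vo|vo1|vF].
    + by apply: (fsubsetP oE0); rewrite !inE vA.
    + by apply: (fsubsetP oE0); rewrite !inE vo orbT.
    + by have := bsn E v Ebs vE; move: vo1; rewrite o1n; clear_lia.
    + by have := bsn E v Ebs vE; move: vF; rewrite Fn; clear_lia.
  move=> v E; rewrite inE => /predU1P[-> //|Ebs] vE; rewrite !inE -!orbA.
  case/or3P=> [vB|->|]; rewrite ?orbT //.
    have /hasP[E' E'bs vE'] := old v E Ebs vE (BN v vB).
    by rewrite (AB v E').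
  by have := bsn E v Ebs vE; rewrite oBn; clear_lia.
- move=> E; rewrite !inE => /or3P[/eqP->|/eqP->|/card' //].
    have := card_fsetU_seq (B `|` [fset v in F]) oB.
    have := card_fsetU_seq B F.
    rewrite sF soB -/E2; move: BM; clear_lia.
  have := card_fsetU_seq (A `|` [fset v in o] `|` [fset v in o1]) F.
  have := card_fsetU_seq (A `|` [fset v in o]) o1.
  have := card_fsetU_seq A o.
  rewrite sF so1 so -/E1; move: AM; clear_lia.
- move=> C; rewrite !in_fsetU -orbA => /or3P[/cov[E Ebs CE]|/psi1V ?|/psi2V ?].
  + by exists E; rewrite // !inE Ebs !orbT.
  + by exists E1; rewrite // !inE eqxx orbT.
  + by exists E2; rewrite // !inE eqxx.
- move=> A'; rewrite inE => /predU1P[->|/slot'[o' A'st]].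
    by exists oB; rewrite !inE eqxx orbT.
  have := A'st; rewrite (perm_mem stE) inE => /predU1P[[-> _]|A'st1].
    by exists o1; rewrite !inE eqxx.
  by exists o'; rewrite !inE A'st1 !orbT.
- move=> A' o'; rewrite !inE => /or3P[/eqP[_ ->]|/eqP[_ ->]|/st1st/size'] //.
- move=> A' o'; rewrite !inE => /or3P[/eqP[-> ->]|/eqP[-> ->]|/st1st/bag'[E Ebs sub]].
  + exists E1; first by rewrite !inE eqxx orbT.
    by apply/fsubsetP=> v; rewrite /E1 !inE => /orP[]->; rewrite ?orbT.
  + exists E2; first by rewrite !inE eqxx.
    by apply/fsubsetP=> v; rewrite /E2 !inE => /orP[]->; rewrite ?orbT.
  + by exists E; rewrite // !inE Ebs !orbT.
- rewrite openE' !cat_uniq uo1' uoB u1 andbT /=; apply/andP; split.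
    apply/hasPn=> v; rewrite mem_cat /= o1n oBn => /orP[|vs]; first by clear_lia.
    by have := openn v; rewrite openst vs orbT => /(_ erefl); clear_lia.
  apply/hasPn=> v vs; rewrite /= oBn.
  by have := openn v; rewrite openst vs orbT => /(_ erefl); clear_lia.
- move=> v; rewrite openE' !mem_cat !inE Fn !negb_or o1n oBn => h.
  have vIn : v \notin In.
    case/or3P: h => [h|h|h]; last by rewrite disj' // openst h orbT.
      by apply/negP=> /Inn; move: h; clear_lia.
    by apply/negP=> /Inn; move: h; clear_lia.
  have vo : v \notin o.
    case/or3P: h => [h|h|h]; last exact: uo1.
      by apply/negP=> /on; move: h; clear_lia.
    by apply/negP=> /on; move: h; clear_lia.
  rewrite vIn vo /=; case/or3P: h => [|| h]; try clear_lia.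
  by have := openn v; rewrite openst h orbT => /(_ erefl); clear_lia.
- move=> v; rewrite openE' !mem_cat o1n oBn => /or3P[| |h];
    first [move: Nn; clear_lia | idtac].
  by apply: fro; rewrite openst h orbT.
- move=> v; rewrite !inE Fn => /orP[/orP[/fri //|h]|]; last by move: Nn; clear_lia.
  by apply: fro; rewrite openst h.
- move=> v E; rewrite !inE => /or3P[/eqP->|/eqP->|Ebs vE vN]; last first.
  + by rewrite /= (old v E) ?orbT.
  + rewrite !inE Fn o1n -!orbA => /or4P[vA _|vo vN| |]; try by move: Nn; clear_lia.
      by apply/orP; right; apply/hasP; exists A.
    by move: (oN v vo) vN; clear_lia.
  + rewrite !inE Fn oBn -!orbA => /or3P[vB _|Fv|Bv]; rewrite /= ?vB //.
      by move: Nn Fv; clear_lia.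
    by move: Nn Bv; clear_lia.
(* Three kinds of variables escape the quantification: original ones, fresh ones outside [F], and
   the open counters left untouched. *)
- have dN v : (v < N)%N -> v \in [predC In `|` [fset v in o] `|` [fset v in F]].
    move=> vN; rewrite !inE Fn !negb_or; apply/andP; split; last by move: vN Nn; clear_lia.
    apply/andP; split; first by apply/negP=> /fri; move: vN; clear_lia.
    by apply/negP=> /oN; move: vN; clear_lia.
  have dn v : (n <= v)%N -> v \notin F ->
      v \in [predC In `|` [fset v in o] `|` [fset v in F]].
    move=> vn vF; rewrite !inE (negPf vF) orbF negb_or; apply/andP; split.
      by apply/negP=> /Inn; move: vn; clear_lia.
    by apply/negP=> /on; move: vn; clear_lia.
  have d1 v : v \in open_vars st1 ->
      v \in [predC In `|` [fset v in o] `|` [fset v in F]].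
    move=> v1; rewrite !inE (negPf (uo1 v v1)) (negPf (disj' v _)) ?openst ?v1 ?orbT //=.
    by rewrite Fn; have := openn v; rewrite openst v1 orbT => /(_ erefl); clear_lia.
  have dsub : {subset [predC In `|` [fset v in o] `|` [fset v in F]] <=
      [predC In `|` [fset v in o]]}.
    by move=> v; rewrite !inE !negb_or => /andP[].
  have proj1 : projects (In `|` [fset v in o]) (phi `|` psi1) (fun t =>
      cmp_holds op (count t o1 + count t F +
        (count t (open_vars st1) + num_true t (lits_in X bs)))%N c).
    apply: projects_count => //.
    + by move=> v vo; apply: disj'; rewrite openst vo.
    + apply: depends_onD; apply: depends_on_count => v.
        by rewrite o1n => vo; apply/dsub/dn; rewrite ?Fn; move: vo; clear_lia.
      rewrite Fn !inE negb_or => vF; apply/andP; split.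
        by apply/negP=> /Inn; move: vF; clear_lia.
      by apply/negP=> /on; move: vF; clear_lia.
    + apply: depends_onD; first by apply: depends_on_count => v /d1/dsub.
      by apply: depends_on_num_true => l /XN/dN/dsub.
    + apply: eq_projects proj => t; congr (cmp_holds _ _ _).
      by rewrite (permP openE) count_cat addnA.
  (* For the second elimination [F] is the counter and [o1] joins the part that is carried along;
     the total is regrouped accordingly. *)
  have := @projects_count op c (In `|` [fset v in o]) (phi `|` psi1) psi2 F
    (fun t => count t oB + num_true t Y)%N
    (fun t => count t o1 + (count t (open_vars st1) + num_true t (lits_in X bs)))%N.
  have -> : (fun t => cmp_holds op (count t oB + num_true t Y +
        (count t o1 + (count t (open_vars st1) + num_true t (lits_in X bs))))%N c) =
      (fun t => cmp_holds op (count t (open_vars [:: (A, o1), (B, oB) & st1]) +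
        num_true t (lits_in X (B :: bs)))%N c).
    apply/funext => t; congr (cmp_holds _ _ _).
    by rewrite openE' !count_cat XE num_trueU //; clear_lia.
  apply=> //.
  + move=> v vF; have := vF; rewrite Fn !inE negb_or => vF'; apply/andP; split.
      by apply/negP=> /Inn; move: vF'; clear_lia.
    by apply/negP=> /on; move: vF'; clear_lia.
  + apply: depends_onD.
      by apply: depends_on_count => v; rewrite oBn => vo; apply: dn; rewrite ?Fn; move: vo; clear_lia.
    by apply: depends_on_num_true => l /YB/BN/dN.
  + apply: depends_onD; last apply: depends_onD.
    * by apply: depends_on_count => v; rewrite o1n => vo; apply: dn; rewrite ?Fn; move: vo; clear_lia.
    * by apply: depends_on_count => v /d1.
    * by apply: depends_on_num_true => l /XN/dN.
  + apply: eq_projects proj1 => t; congr (cmp_holds _ _ _); clear_lia.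
Qed.

Lemma partial_encoding_exists bs : rip bs ->
  (forall E, E \in bs -> {in E, forall v, v < N} /\ #|` E| <= M)%N ->
  exists bs' phi In st, PE bs bs' phi In st.
Proof.
elim=> [B|A B {}bs _ IHbs Abs BA] bsN.
  by have [|BN BM] := bsN B; [rewrite inE|exact: partial_encoding_seq1].
have [|bs' [phi [In [st pe]]]] := IHbs.
  by move=> E Ebs; apply: bsN; rewrite inE Ebs orbT.
exact: partial_encoding_cons pe Abs BA bsN.
Qed.

(** Unit clauses set all open counters to zero, so that the projected condition becomes the
    constraint on the literals alone. Every literal of [X] is counted, since its variable occurs in
    some bag. *)
Lemma card_encoding_exists bs : rip bs ->
  (forall E, E \in bs -> {in E, forall v, v < N} /\ #|` E| <= M)%N ->
  {in X, forall l, has (fun B : {fset nat} => l.1 \in B) bs} ->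
  exists bs' phi, [/\ rip bs',
    forall E, E \in bs' -> (#|` E| <= M + 3 * c.+1)%N,
    forall B, B \in bs -> exists2 E, E \in bs' & B `<=` E,
    forall C, C \in phi -> exists2 E, E \in bs' & clause_vars C `<=` E
    & forall t, (exists2 s, {in gtn N, s =1 t} & satisfies s phi) <->
        cmp_holds op (num_true t X) c].
Proof.
move=> bs_rip bsN Xbs.
have [bs' [phi [In [st [rip' card' cov slot' size' bag' uniq' disj' fro fri old proj]]]]] :=
  partial_encoding_exists bs_rip bsN.
have XE : lits_in X bs = X.
  by apply/fsetP=> l; rewrite !inE; case: (boolP (l \in X)) => //= /Xbs.
rewrite XE in proj.
have XN l : l \in X -> (l.1 < N)%N.
  by case/Xbs/hasP=> E /bsN[EN _] /EN.
pose neg v : clause := [fset (v, false)].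
exists bs', (phi `|` [fset neg v | v in open_vars st]); split=> //.
- move=> B /slot'[o /bag'[E Ebs sub]]; exists E => //.
  exact: fsubset_trans (fsubsetUl _ _) sub.
- move=> C; rewrite inE => /orP[/cov //|/imfsetP[v /= vst ->]].
  case/flatten_mapP: vst => -[A o] /bag'[E Ebs sub] /= vo; exists E => //.
  apply/fsubsetP=> u /clause_varsP[l /[!inE]/eqP-> ->] /=.
  by apply: (fsubsetP sub); rewrite !inE vo orbT.
- move=> t; split.
    case=> s st' /satisfiesU[sphi sneg].
    have : cmp_holds op (count s (open_vars st) + num_true s X)%N c.
      by apply/proj; exists s.
    rewrite (@eq_in_count _ _ pred0) ?count_pred0 => [|v vo].
      by rewrite (@depends_on_num_true (gtn N) X XN _ _ st').
    have [|l] := sneg (neg v); first by apply/imfsetP; exists v.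
    by rewrite inE /lit_true => /eqP-> /eqP.
  (* The open counters lie at or above [N], so [t0] sets them to zero while agreeing with [t] on the
     variables of [X]. They are outside [In], so the solution [s] keeps them at zero. *)
  move=> h; pose t0 v := (v < N)%N && t v.
  have t0t : {in gtn N, t0 =1 t} by move=> v; rewrite inE /t0 => ->.
  have [s st0 sphi] : exists2 s, {in [predC In], s =1 t0} & satisfies s phi.
    apply/proj; rewrite (@eq_in_count _ _ pred0) ?count_pred0 => [|v /fro vN].
      by rewrite (@depends_on_num_true (gtn N) X XN _ _ t0t).
    by rewrite /t0 ltnNge vN.
  exists s => [v vN|].
    rewrite st0 ?t0t // inE; apply/negP=> /fri.
    by move: vN; rewrite inE; lia.
  apply/satisfiesU; split=> // C /imfsetP[v /= vo ->].
  exists (v, false); first by rewrite inE.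
  rewrite /lit_true /= st0 ?inE ?disj' //.
  by rewrite /t0 ltnNge fro.
Qed.
End Encoding.

(** * Treewidth of the conjunction *)

Lemma varsP (psi : cnf) v :
  reflect (exists2 C, C \in psi & v \in clause_vars C) (v \in vars psi).
Proof.
apply: (iffP (bigfcupP _ _ _ _)) => [[C /andP[Cpsi _] vC]|[C Cpsi vC]]; exists C => //.
by rewrite Cpsi.
Qed.

Lemma primal_graphP (psi : cnf) (x y : vars psi) :
  reflect (val x != val y /\ exists2 C, C \in psi &
      (val x \in clause_vars C) && (val y \in clause_vars C))
    (primal_graph x y).
Proof.
apply: (iffP andP) => -[xy].
  by case/existsP=> C /= h; split=> //; exists (val C) => //; apply: valP.
by case=> C Cpsi h; split=> //; apply/existsP; exists [` Cpsi].
Qed.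

Lemma treewidth_le (V : finType) (e : rel V) (D : tree_decomposition e) (w : nat) :
  max_bag D <= w -> (treewidth e <= w%:Z - 1)%R.
Proof.
move=> Dw; rewrite /treewidth; case: ex_minnP => m _ /(_ (max_bag D)) mD.
have : m <= max_bag D by apply: mD; apply/asboolP; exists D.
by move/leq_trans/(_ Dw) => mw; rewrite lerD2r lez_nat.
Qed.

(** It is enough that any two variables of a clause share a bag. This is what a decomposition of a
    primal graph provides directly, without the fact that a clique lies in a single bag. *)
Lemma tw_le_rip (psi : cnf) (bs : seq {fset nat}) (w : nat) :
  rip bs -> (forall B, B \in bs -> #|` B| <= w) ->
  (forall C, C \in psi -> {in clause_vars C &, forall u v,
    exists2 B, B \in bs & (u \in B) && (v \in B)}) ->
  (tw psi <= w%:Z - 1)%R.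
Proof.
move=> /rip_tree[I [t [bag [tree_t bagE bagC]]]] bsw cover.
(* Bags may hold numbers that are not variables of the formula; these are dropped, which can only
   make bags smaller. *)
pose sbag i : {set vars psi} := [set x | val x \in bag i].
have vertex (x : vars psi) : exists i, x \in sbag i.
  have /varsP[C Cpsi xC] := valP x.
  have [B /bagE[i <-] /andP[xB _]] := cover C Cpsi _ _ xC xC.
  by exists i; rewrite inE.
have edge (x y : vars psi) : primal_graph x y ->
    exists i, (x \in sbag i) && (y \in sbag i).
  case/primal_graphP=> _ [C Cpsi /andP[xC yC]].
  have [B /bagE[i <-] xyB] := cover C Cpsi _ _ xC yC.
  by exists i; rewrite !inE.
have conn (x : vars psi) i j : x \in sbag i -> x \in sbag j ->
    connect [rel a b | [&& t a b, x \in sbag a & x \in sbag b]] i j.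
  rewrite !inE => xi xj; rewrite (eq_connect (e' :=
    [rel a b | [&& t a b, val x \in bag a & val x \in bag b]])); last first.
    by move=> a b; rewrite /= !inE.
  exact: bagC.
apply: (@treewidth_le _ _ (TreeDecomposition tree_t vertex edge conn)).
apply/bigmax_leqP => i _ /=; apply: (leq_trans _ (bsw (bag i) _)); last first.
  by apply/bagE; exists i.
rewrite cardE -(size_map val); apply: uniq_leq_size.
  by rewrite (map_inj_uniq val_inj) enum_uniq.
by move=> _ /mapP[x /[!mem_enum] /[!inE] xi ->].
Qed.

(** The bags are moved from the finite type of variables of [psi] to sets of naturals, where fresh
    variables can be added. *)
Lemma tree_decomposition_rip (psi : cnf) (D : tree_decomposition (@primal_graph psi)) :
  exists bs, [/\ rip bs,
    forall B, B \in bs -> B `<=` vars psi /\ #|` B| <= max_bag D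
    & forall C, C \in psi -> {in clause_vars C &, forall u v,
        exists2 B, B \in bs & (u \in B) && (v \in B)}].
Proof.
pose bag (i : td_node D) : {fset nat} := [fset val x | x in td_bag i].
have bagP (x : vars psi) i : (val x \in bag i) = (x \in td_bag i).
  by rewrite mem_imfset //; apply: val_inj.
have bag_connected v i j : v \in bag i -> v \in bag j ->
    connect [rel a b | [&& td_edge a b, v \in bag a & v \in bag b]] i j.
  case/imfsetP=> x /= xi ->; rewrite bagP => xj.
  rewrite (eq_connect (e' :=
    [rel a b | [&& td_edge a b, x \in td_bag a & x \in td_bag b]])).
    exact: td_connected.
  by move=> a b; rewrite /= !bagP.
have [s sT s_rip] := tree_rip (td_tree D) bag_connected.
exists (map bag s); split=> // [B /mapP[i _ ->]|C Cpsi u v uC vC].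
  split; first by apply/fsubsetP=> _ /imfsetP[x /= _ ->]; apply: valP.
  rewrite card_imfset /=; last exact: val_inj.
  by rewrite -cardE; apply: (@leq_bigmax _ (fun i : td_node D => #|td_bag i|) i).
have upsi : u \in vars psi by apply/varsP; exists C.
have vpsi : v \in vars psi by apply/varsP; exists C.
pose x : vars psi := [` upsi]; pose y : vars psi := [` vpsi].
have [i xyi] : exists i : td_node D, (x \in td_bag i) && (y \in td_bag i).
  (* The primal graph has no loops, so for equal variables the bag comes from vertex coverage
     instead of edge coverage. *)
  have [<-|xy] := eqVneq x y.
    by have [i xi] := td_vertex D x; exists i; rewrite xi.
  by apply/td_cover/primal_graphP; split=> //; exists C; rewrite //= uC.
by exists (bag i); [exact: map_f|rewrite -!bagP in xyi].
Qed.

Local Open Scope ring_scope.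

Theorem lemma12 (c : nat) (op : cmp) (psi : cnf) (X : {fset lit})
    (hX : X `<=` lits psi)
    (D : tree_decomposition (@primal_graph psi)) (k : int) (hk : width D = k) :
  exists phi : cnf,
    encodes_card psi op c X phi /\
    tw (cnf_and psi phi) <= k + 3 * c%:Z + 3.
Proof.
have [bs [bs_rip bs_size psi_cover]] := tree_decomposition_rip D.
have [N psiN] := fset_bound (vars psi).
have Xpsi l : l \in X -> l.1 \in vars psi.
  by move/(fsubsetP hX); rewrite in_fsetM => /andP[].
have [||bs' [phi [rip' size' sub' phi_cover phiE]]] :=
  @card_encoding_exists op c X N (max_bag D) bs bs_rip.
- move=> B /bs_size[Bpsi BM]; split=> // v vB.
  by apply: psiN; apply: (fsubsetP Bpsi).
- move=> l /Xpsi/varsP[C Cpsi lC]; apply/hasP.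
  by have [B Bbs /andP[lB _]] := psi_cover C Cpsi _ _ lC lC; exists B.
exists phi; split=> [beta|]; last first.
  (* With [k] equal to [max_bag D - 1], three counters of [c.+1] variables contribute exactly
     [3c + 3]. *)
  have -> : k + 3 * c%:Z + 3 = (max_bag D + 3 * c.+1)%N%:Z - 1.
    by rewrite -hk /width; lia.
  apply: (tw_le_rip rip' size') => C; rewrite inE => /orP[Cpsi|Cphi] u v uC vC.
    have [B /sub'[E Ebs BE] /andP[uB vB]] := psi_cover C Cpsi _ _ uC vC.
    by exists E; rewrite ?(fsubsetP BE).
  have [E Ebs CE] := phi_cover C Cphi.
  by exists E; rewrite ?(fsubsetP CE).
split=> [[s sbeta sphi]|/phiE[s sbeta sphi]]; last first.
  by exists s => // v /psiN vN; apply: sbeta; rewrite inE.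
(* Since [s] agrees with [beta] only on [vars psi], and not on all numbers below [N], [phiE] is
   applied at [s] itself; the count over [X] is the same for both. *)
have <- : num_true s X = num_true beta X.
  exact: (@depends_on_num_true [in vars psi] _ Xpsi _ _ sbeta).
by apply/phiE; exists s.
Qed.
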